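(* Let $G=(V,E)$ be a $d$-regular graph with diameter $D \geq 4$. Then, for any $\beta > 1$, there exists a $\beta$-Lipschitz edge-weighting $w : E \to \mathbb{R}_+$ such that the chain $P_w$ induced by $w$ satisfies \[ \gamma_{P_w} \le \beta^2 (d/\beta)^{\lfloor D/2 \rfloor-1}. \]
   Context: All graphs are finite, simple, undirected and connected. $\mathbb{R}_+$ denotes the positive reals. The diameter is the maximum graph distance between two vertices. For an edge-weighting $w:E\to\mathbb{R}_+$, the chain $P_w$ induced by $w$ has $P_w(x,y)=w(x,y)/w(x)$ if $\{x,y\}\in E$ and $P_w(x,y)=0$ otherwise, where $w(x)=\sum_{z:\,z\sim x}w(x,z)$. It is reversible. For $\beta\ge 1$, $w$ is $\beta$-Lipschitz if $1/\beta\le w(x,y)/w(x,z)\le\beta$ for all $x,y,z\in V$ with $y\sim x\sim z$. The spectral gap of a reversible irreducible chain $P$ with eigenvalues $1=\lambda_1>\lambda_2\ge\dots\ge\lambda_n\ge-1$ is $\gamma_P=1-\lambda_2$. *)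

(* Defs.v *)
From HB Require Import structures.
From mathcomp Require Import all_boot all_order all_algebra.
From mathcomp Require Import polyrcf.
From mathcomp Require Import reals.

Set Implicit Arguments.
Unset Strict Implicit.
Unset Printing Implicit Defensive.

Import Order.TTheory GRing.Theory Num.Theory.

Local Open Scope ring_scope.

(* A finite simple graph is a symmetric irreflexive relation on a finType. *)
Definition connected_simple_graph (V : finType) (e : rel V) : Prop :=
  [/\ symmetric e, irreflexive e & forall x y : V, connect e x y].

Definition regular (V : finType) (e : rel V) (d : nat) : Prop :=
  forall x : V, #|[set y | e x y]| = d.

Definition walk (V : finType) (e : rel V) (k : nat) (x y : V) : bool :=
  [exists p : k.-tuple V, path e x p && (last x p == y)].

(* A shortest walk has length < #|V|, so the search always succeeds when x and
   y are connected; otherwise the value is #|V|. *)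
Definition graph_dist (V : finType) (e : rel V) (x y : V) : nat :=
  find (fun k => walk e k x y) (iota 0 #|V|).

Definition diameter (V : finType) (e : rel V) : nat :=
  (\max_(x : V) \max_(y : V) graph_dist e x y)%N.

(* A weighting E -> R_+ is a function on ordered pairs, symmetric on edges; its
   values on non-edges are irrelevant. *)
Definition edge_weighting (R : realType) (V : finType) (e : rel V)
    (w : V -> V -> R) : Prop :=
  forall x y : V, e x y -> w x y = w y x /\ 0 < w x y.

Definition lipschitz_weighting (R : realType) (V : finType) (e : rel V)
    (beta : R) (w : V -> V -> R) : Prop :=
  forall x y z : V, e x y -> e x z -> 1 / beta <= w x y / w x z <= beta.

Definition vertex_weight (R : realType) (V : finType) (e : rel V)
    (w : V -> V -> R) (x : V) : R :=
  \sum_(z : V | e x z) w x z.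

Definition induced_chain (R : realType) (V : finType) (e : rel V)
    (w : V -> V -> R) (x y : V) : R :=
  if e x y then w x y / vertex_weight e w x else 0.

Definition chain_matrix (R : realType) (V : finType) (P : V -> V -> R) :
    'M[R]_#|V| :=
  \matrix_(i, j) P (enum_val i) (enum_val j).

(* The real eigenvalues in nonincreasing order, repeated according to algebraic
   multiplicity. The matrix of a reversible chain is similar to a real symmetric
   one, so in that case this list has length n. *)
Definition eigenvalues (R : realType) (n : nat) (A : 'M[R]_n) : seq R :=
  flatten [seq nseq (mup x (char_poly A)) x | x <- rev (rootsR (char_poly A))].

(* 1 - lambda_2; sequences are indexed from 0. *)
Definition spectral_gap (R : realType) (V : finType) (P : V -> V -> R) : R :=
  1 - (eigenvalues (chain_matrix P))`_1.

(* Main.v *)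
Require Import Defs.
From HB Require Import structures.
From mathcomp Require Import all_boot all_order all_algebra.
From mathcomp Require Import polyrcf complex ring zify.
From mathcomp Require Import reals.

(** Pick vertices a and b at distance D, let h x be the distance from x to the
    nearer of a and b, and give an edge xy the weight
    beta^-min(h x, h y). As h changes by at most 1 along an edge, this weighting
    is beta-Lipschitz.

    Let r = D./2 - 1, so that 2 (r + 1) <= D and the balls of radius r around a
    and b are disjoint and joined by no edge. An edge leaving the ball around a
    goes from distance r to distance r + 1, where the far centre b is at least
    as distant, so its weight is exactly beta^-r; there are at most d^(r+1) such
    edges, because at most d^r vertices are reached by walks of length r. The
    ball has volume at least the weight of its centre, which is d because all
    edges at the centre have weight 1. So the boundary weight
    of each ball is at most (d / beta)^r times its volume ([cut_ball_le]), and
    (d / beta)^r <= beta^2 (d / beta)^r as beta > 1.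

    The spectral gap is at most the larger of the two ratios of boundary weight
    to volume ([spectral_gap_le_cut]): on the plane spanned by the indicators of
    two non-adjacent sets the Dirichlet form is diagonal, and by the
    Courant-Fischer principle a plane on which the quadratic form of a symmetric
    matrix is at least c times the squared norm forces two eigenvalues to be at
    least c ([second_eigenvalue_ge]). That principle is derived from unitary
    diagonalization over the complex numbers. *)

Import Order.TTheory GRing.Theory Num.Theory.

Set Implicit Arguments.
Unset Strict Implicit.
Unset Printing Implicit Defensive.

Local Open Scope ring_scope.

(** * The list of real eigenvalues *)

Lemma char_poly_intertwined (F : fieldType) n (P A B : 'M[F]_n) :
  P \in unitmx -> P *m A = B *m P -> char_poly A = char_poly B.
Proof.
move=> P_unit PA; pose Q := map_mx polyC P.
have detQ : \det Q != 0.
  by rewrite det_map_mx polyC_eq0 -unitfE -unitmxE.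
apply: (mulfI detQ); rewrite /char_poly /char_poly_mx -det_mulmx mulrC -det_mulmx.
congr (\det _); rewrite mulmxBr mulmxBl -!map_mxM PA.
by rewrite scalar_mxC.
Qed.

(** When the characteristic polynomial splits over the reals, the real roots
    counted with multiplicity account for the whole spectrum, so a position in
    the list of eigenvalues can be read off from any diagonal form. *)
Lemma perm_eigenvalues (R : realType) n (A : 'M[R]_n) (s : seq R) :
  char_poly A = \prod_(a <- s) ('X - a%:P) -> perm_eq (eigenvalues A) s.
Proof.
move=> chiA; set p := char_poly A in chiA *.
have p_neq0 : p != 0 by rewrite monic_neq0 ?char_poly_monic.
apply/allP => x _ /=; apply/eqP; rewrite -[RHS]mu_prod_XsubC -chiA.
rewrite /eigenvalues -/p count_flatten -map_comp map_rev sumn_rev sumnE big_map.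
under eq_bigr => y _ do rewrite /= count_nseq /= mulnC.
have rootsRE : x \in rootsR p = root p x.
  by rewrite -(roots_on_rootsR p_neq0 x) inE /=.
have [px|Npx] := boolP (root p x); last first.
  rewrite big1_seq => [|y /= y_root]; first by rewrite mupNroot.
  by case: eqVneq y_root => [->|_]; rewrite ?muln0 // rootsRE (negbTE Npx).
have uniq_roots : uniq (rootsR p).
  by apply: (sorted_uniq lt_trans ltxx); apply: sorted_roots.
rewrite (bigD1_seq x) ?rootsRE //=.
by rewrite eqxx muln1 big1 ?addn0 // => y /negbTE->; rewrite muln0.
Qed.

Lemma sorted_eigenvalues (R : realType) n (A : 'M[R]_n) :
  sorted >=%R (eigenvalues A).
Proof.
rewrite /eigenvalues; set p := char_poly A.
have : sorted >=%R (rev (rootsR p)).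
  rewrite rev_sorted; apply: sub_sorted (sorted_roots _ _ _) => x y; exact: ltW.
rewrite !(sorted_pairwise ge_trans).
elim: (rev _) => //= x s IHs /andP[x_ge /IHs s_sorted].
rewrite pairwise_cat s_sorted andbT; apply/andP; split.
  apply/allrelP => y z; rewrite mem_nseq => /andP[_ /eqP->].
  case/flatten_mapP => t ts; rewrite mem_nseq => /andP[_ /eqP->].
  exact: (allP x_ge).
by elim: (mup x p) => //= m ->; rewrite andbT all_nseq /= lexx orbT.
Qed.

Lemma sorted_nth1_ge (R : realType) (c : R) (s : seq R) :
  sorted >=%R s -> (1 < count (>= c) s)%N -> c <= s`_1.
Proof.
case: s => [|x [|y s]] //=; first by case: (c <= x).
case/andP => xy; rewrite path_sortedE; last exact: ge_trans.
case/andP => /allP y_ge _; apply: contraTT; rewrite -ltNge => yc.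
rewrite -leqNgt (leNgt c y) yc add0n.
rewrite (@eq_in_count _ _ pred0) ?count_pred0 ?addn0 ?leq_b1 // => z /y_ge zy.
by apply/negbTE; rewrite -ltNge; apply: le_lt_trans yc.
Qed.

(** * The Courant-Fischer principle for the second eigenvalue *)

Local Open Scope sesquilinear_scope.

(** A real symmetric matrix is Hermitian over the complex numbers, hence
    unitarily diagonalizable with real diagonal, which already gives the
    factorization of the characteristic polynomial over the reals. *)
Lemma symmetric_spectral (R : realType) n (S : 'M[R]_n) : S^T = S ->
  exists U : 'M[R[i]]_n, exists r : 'I_n -> R,
  [/\ U *m U^t* = 1%:M,
     map_mx (real_complex R) S
       = U^t* *m diag_mx (\row_i real_complex R (r i)) *m U &
     char_poly S = \prod_(i < n) ('X - (r i)%:P)].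
Proof.
move=> S_sym; set S' := map_mx _ S.
have S'_real : S' \is a mxOver Num.real.
  apply/mxOverP => i j; rewrite mxE.
  by apply/complex_realP; exists (S i j).
have S'_sym : S' \is symmetricmx.
  by apply/is_hermitianmxP; rewrite expr0 scale1r map_mx_id // /S' map_trmx S_sym.
have S'_herm := realsym_hermsym S'_sym S'_real.
pose U := spectralmx S'; pose r i := complex.Re (spectral_diag S' 0 i).
have U_unitary := spectral_unitarymx S'.
have rE : spectral_diag S' = \row_i real_complex R (r i).
  apply/rowP => i; rewrite !mxE RRe_real //.
  exact: (mxOverP (hermitian_spectral_diag_real S'_herm)).
have := orthomx_spectralP (hermitian_normalmx S'_herm).
rewrite rE => S'E; exists U, r; split.
- exact/unitarymxP.
- by rewrite S'E invmx_unitary.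
apply: (@map_poly_inj _ _ (real_complex R)).
rewrite map_char_poly -/S'.
rewrite (@char_poly_intertwined _ _ U _ (diag_mx (\row_i real_complex R (r i)))).
- rewrite char_poly_trig ?diag_mx_is_trig // map_prod_XsubC.
  by apply: eq_bigr => i _; rewrite !mxE eqxx mulr1n.
- exact: spectral_unit.
by rewrite {1}S'E -mulmxA mulKVmx ?spectral_unit.
Qed.

(** If at most one eigenvalue were at least c, the complex span of u and v, being
    of dimension 2, would contain a nonzero vector y orthogonal to an
    eigenvector for it. In eigencoordinates y S y* is then less than c y y*, while
    orthogonality of u and v for both forms makes it at least c y y*. The span
    is taken over the complex numbers because the diagonalizing basis is complex. *)
Lemma second_eigenvalue_ge (R : realType) n (S : 'M[R]_n) (u v : 'rV[R]_n)
    (c : R) :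
  S^T = S -> u != 0 -> v != 0 -> u *m v^T = 0 -> u *m S *m v^T = 0 ->
  c * (u *m u^T) 0 0 <= (u *m S *m u^T) 0 0 ->
  c * (v *m v^T) 0 0 <= (v *m S *m v^T) 0 0 ->
  c <= (eigenvalues S)`_1.
Proof.
move=> S_sym u0 v0 uv uSv cu cv.
have [U [r [U_unitary SE chiS]]] := symmetric_spectral S_sym.
apply: sorted_nth1_ge; first exact: sorted_eigenvalues.
have /permP -> : perm_eq (eigenvalues S) [seq r i | i <- enum 'I_n].
  by apply: perm_eigenvalues; rewrite chiS big_map big_enum.
rewrite count_map -sum1_count big_enum_cond sum1_card.
rewrite ltnNge; apply/negP => /card_le1P few.
set toC := real_complex R in SE.
have toCB x y : toC (x - y) = toC x - toC y by exact: rmorphB.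
have toCM x y : toC (x * y) = toC x * toC y by exact: rmorphM.
pose uC := map_mx toC u; pose vC := map_mx toC v.
have toCtr m (x : 'rV[R]_m) : (map_mx toC x)^t* = map_mx toC x^T.
  by apply/matrixP => i j; rewrite !mxE; apply/CrealP/complex_realP; exists (x j i).
pose z a b := (a *: uC + b *: vC) *m U^t*.
(* One linear condition on (a, b): z a b holds the eigencoordinates of
   a u + b v, and its entry at the only large eigenvalue has to vanish. *)
have [a [b [ab0 zE]]] : exists a, exists b,
    (a != 0) || (b != 0) /\ forall i, c <= r i -> z a b 0 i = 0.
  pose a0 i := (uC *m U^t*) 0 i; pose b0 i := (vC *m U^t*) 0 i.
  have zE a b i : z a b 0 i = a * a0 i + b * b0 i.
    rewrite /z mulmxDl -!scalemxAl /a0 /b0.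
    by move: (uC *m _) (vC *m _) => x y; rewrite !mxE.
  have [i0 ci0|none] := pickP [pred i | c <= r i]; last first.
    exists 1, 0; split=> [|i ci]; first by rewrite oner_eq0.
    by case/negP: (negbT (none i)).
  have only i : c <= r i -> i = i0.
    move=> ci; apply/eqP; rewrite -[_ == _]/(i \in pred1 i0) -(few i0 ci0 i).
    exact: ci.
  have [/andP[/eqP a00 /eqP b00]|nz] := boolP ((a0 i0 == 0) && (b0 i0 == 0)).
    by exists 1, 0; split=> [|i /only ->]; rewrite ?oner_eq0 // zE a00 b00 !mulr0 addr0.
  exists (b0 i0), (- a0 i0); split=> [|i /only->].
    by rewrite oppr_eq0 orbC -negb_and.
  by rewrite zE mulNr mulrC subrr.
(* For M = S and M = 1, orthogonality of u and v for M kills the cross terms. *)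
have form (M : 'M[R]_n) : u *m M *m v^T = 0 -> M^T = M ->
   ((a *: uC + b *: vC) *m map_mx toC M *m (a *: uC + b *: vC)^t*) 0 0 =
   `|a| ^+ 2 * toC ((u *m M *m u^T) 0 0) + `|b| ^+ 2 * toC ((v *m M *m v^T) 0 0).
  move=> uMv M_sym.
  have vMu : v *m M *m u^T = 0.
    by rewrite -[RHS]trmx0 -uMv !trmx_mul trmxK M_sym mulmxA.
  rewrite linearD /= map_mxD !linearZ /= !map_mxZ !toCtr.
  rewrite !(mulmxDl, mulmxDr) -!scalemxAl -!scalemxAr -!map_mxM.
  rewrite uMv vMu map_mx0 !scaler0 addr0 add0r !scalerA.
  by move: (u *m _ *m _) (v *m _ *m _) => x y; rewrite !mxE !normCK.
have sum_form (e : 'I_n -> R) :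
    (z a b *m diag_mx (\row_i toC (e i)) *m (z a b)^t*) 0 0
      = \sum_i toC (e i) * `|z a b 0 i| ^+ 2.
  rewrite mxE; apply: eq_bigr => i _.
  by rewrite mul_mx_diag !mxE normCK -mulrA mulrCA.
have zUE : z a b *m U = a *: uC + b *: vC.
  by rewrite /z -mulmxA (mulmx1C U_unitary) mulmx1.
have zUtE : U^t* *m (z a b)^t* = (a *: uC + b *: vC)^t*.
  by rewrite -map_mxM -trmx_mul zUE.
have S_form := form S uSv S_sym.
have I_form := form 1%:M _ (@trmx1 _ _).
rewrite !mulmx1 in I_form; have {}I_form := I_form uv.
have S_sum : \sum_i toC (r i) * `|z a b 0 i| ^+ 2 =
    `|a| ^+ 2 * toC ((u *m S *m u^T) 0 0) + `|b| ^+ 2 * toC ((v *m S *m v^T) 0 0).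
  rewrite -S_form -sum_form SE -zUtE -zUE !mulmxA -(mulmxA _ U) U_unitary mulmx1.
  by rewrite -(mulmxA _ U) U_unitary mulmx1.
have I_sum : \sum_i `|z a b 0 i| ^+ 2 =
    `|a| ^+ 2 * toC ((u *m u^T) 0 0) + `|b| ^+ 2 * toC ((v *m v^T) 0 0).
  rewrite -I_form map_mx1 mulmx1 -{1}zUE -zUtE mulmxA -(mulmxA _ U) U_unitary mulmx1 mxE.
  by apply: eq_bigr => i _; rewrite !mxE normCK.
have norm_gt0 (x : 'rV[R]_n) : x != 0 -> 0 < (x *m x^T) 0 0.
  case/rV0Pn => i xi; rewrite mxE (bigD1 i) //= mxE -expr2.
  rewrite ltr_pwDl ?exprn_even_gt0 // sumr_ge0 // => j _.
  by rewrite mxE -expr2 sqr_ge0.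
have z_neq0 : 0 < \sum_i `|z a b 0 i| ^+ 2.
  have nu := norm_gt0 u u0; have nv := norm_gt0 v v0.
  rewrite I_sum; case/orP: ab0 => x0; [apply: ltr_pwDl | apply: ltr_wpDl];
    by rewrite ?mulr_gt0 ?mulr_ge0 ?exprn_ge0 ?exprn_gt0 ?normr_ge0 ?normr_gt0 ?ltcR ?lecR // ltW.
(* The sum of these nonnegative terms turns out to be nonpositive. *)
have term_ge0 i : toC (c - r i) * `|z a b 0 i| ^+ 2 >= 0.
  have [/zE ->|rc] := leP c (r i); first by rewrite normr0 expr0n mulr0.
  by rewrite mulr_ge0 ?exprn_ge0 // lecR subr_ge0 ltW.
have : \sum_i toC (c - r i) * `|z a b 0 i| ^+ 2 <= 0.
  under eq_bigr do rewrite toCB mulrBl.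
  rewrite sumrB -mulr_sumr S_sum I_sum subr_le0 mulrDr !(mulrCA (toC c)) -!toCM.
  by rewrite lerD // ler_wpM2l ?exprn_ge0 // lecR.
move=> sum_le0; have : \sum_i toC (c - r i) * `|z a b 0 i| ^+ 2 == 0.
  by rewrite eq_le sum_le0 sumr_ge0.
rewrite psumr_eq0 // => /allP all0.
move: z_neq0; rewrite big1 ?ltxx // => i _; have := all0 i (mem_index_enum i).
have [/zE ->|rc] := leP c (r i); first by rewrite normr0 expr0n.
by rewrite mulf_eq0 (fmorph_eq0 toC) subr_eq0 gt_eqF //= => /eqP.
Qed.

Local Close Scope sesquilinear_scope.

(** * Two non-adjacent sets bound the spectral gap *)

Definition volume (R : realType) (V : finType) (e : rel V) (w : V -> V -> R)
    (A : {set V}) : R :=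
  \sum_(x in A) vertex_weight e w x.

Definition cut_weight (R : realType) (V : finType) (e : rel V)
    (w : V -> V -> R) (A : {set V}) : R :=
  \sum_(x in A) \sum_(y | e x y && (y \notin A)) w x y.

(** The chain is similar to the symmetric matrix S with entries
    w x y / sqrt (w x * w y), conjugation being by the diagonal matrix of the
    sqrt (w x). The vectors sqrt (w x) restricted to A and to B are orthogonal
    for the scalar product as A and B are disjoint, and for S as A and B are not
    adjacent; on such a vector S takes the value volume minus boundary weight,
    and the squared norm is the volume. *)
Lemma spectral_gap_le_cut (R : realType) (V : finType) (e : rel V)
    (w : V -> V -> R) (A B : {set V}) (eps : R) :
  symmetric e -> edge_weighting e w -> (forall x, 0 < vertex_weight e w x) ->
  A != set0 -> B != set0 -> [disjoint A & B] ->
  (forall x y, x \in A -> y \in B -> ~~ e x y) ->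
  cut_weight e w A <= eps * volume e w A ->
  cut_weight e w B <= eps * volume e w B ->
  spectral_gap (induced_chain e w) <= eps.
Proof.
move=> e_sym w_edge vw_gt0 A0 B0 AB_disj AB_nadj cutA cutB.
pose q x y := if e x y then w x y else 0.
pose s x := Num.sqrt (vertex_weight e w x).
have s_neq0 x : s x != 0 by rewrite gt_eqF // sqrtr_gt0.
have sqr_s x : s x * s x = vertex_weight e w x.
  by rewrite -expr2 sqr_sqrtr // ltW.
pose S : 'M[R]_#|V| :=
  \matrix_(i, j) (q (enum_val i) (enum_val j) / (s (enum_val i) * s (enum_val j))).
pose f (X : {set V}) : 'rV[R]_#|V| :=
  \row_i (if enum_val i \in X then s (enum_val i) else 0).
have sum_enum (F : V -> R) : \sum_(i < #|V|) F (enum_val i) = \sum_x F x.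
  by rewrite -(@big_enum_val _ 0 +%R V V F).
have S_sym : S^T = S.
  apply/matrixP => i j; rewrite !mxE /q e_sym mulrC [s _ * _]mulrC mulrC.
  by case: ifP => // /w_edge[->].
have fSf X Y : (f X *m S *m (f Y)^T) 0 0 = \sum_(x in X) \sum_(y in Y) q x y.
  rewrite mxE exchange_big [RHS]big_mkcond.
  rewrite -sum_enum; apply: eq_bigr => j _.
  rewrite !mxE; case: ifP => _; last by rewrite mulr0.
  rewrite [RHS]big_mkcond -sum_enum mulr_suml; apply: eq_bigr => i _.
  rewrite !mxE; case: ifP => _; last by rewrite !mul0r.
  by field; rewrite !s_neq0.
have ff X Y : (f X *m (f Y)^T) 0 0 = volume e w (X :&: Y).
  rewrite mxE /volume [RHS]big_mkcond -sum_enum; apply: eq_bigr => i _.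
  by rewrite !mxE inE; do 2 case: ifP => _; rewrite ?mul0r ?mulr0 ?sqr_s.
have inside (X : {set V}) :
    \sum_(x in X) \sum_(y in X) q x y = volume e w X - cut_weight e w X.
  rewrite /volume /cut_weight -sumrB; apply: eq_bigr => x _.
  rewrite /vertex_weight (bigID (mem X) (e x)) /= addrK.
  rewrite [in LHS]big_mkcond [RHS]big_mkcond; apply: eq_bigr => y _.
  by rewrite /q; case: (e x y); case: (y \in X).
have f_neq0 (X : {set V}) : X != set0 -> f X != 0.
  case/set0Pn => x xX; apply/rV0Pn; exists (enum_rank x).
  by rewrite mxE enum_rankK xX.
have chi_eq : char_poly (chain_matrix (induced_chain e w)) = char_poly S.
  pose T : 'M[R]_#|V| := diag_mx (\row_i s (enum_val i)).
  apply: (@char_poly_intertwined _ _ T).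
    by rewrite unitmxE det_diag unitfE; apply/prodf_neq0 => i _; rewrite mxE.
  apply/matrixP => i j; rewrite mul_diag_mx mul_mx_diag !mxE /induced_chain /q.
  case: ifP => _; last by rewrite mulr0 !mul0r.
  by rewrite -sqr_s; field; rewrite !s_neq0.
rewrite /spectral_gap /eigenvalues chi_eq -/(eigenvalues S) lerBlDr addrC -lerBlDr.
apply: (@second_eigenvalue_ge _ _ _ (f A) (f B)) => //; try exact: f_neq0.
- apply/matrixP => i j; rewrite !ord1 ff mxE.
  by rewrite disjoint_setI0 // /volume big_set0.
- apply/matrixP => i j; rewrite !ord1 fSf mxE big1 // => x xA.
  by rewrite big1 // => y yB; rewrite /q (negbTE (AB_nadj _ _ xA yB)).
- by rewrite ff fSf inside setIid mulrBl mul1r lerB.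
- by rewrite ff fSf inside setIid mulrBl mul1r lerB.
Qed.

(** * Walks and distances *)

Lemma walkP (V : finType) (e : rel V) k (x y : V) :
  reflect (exists p, [/\ size p = k, path e x p & last x p = y]) (walk e k x y).
Proof.
apply: (iffP existsP) => [[p /andP[xp /eqP py]]|[p [/eqP pk xp py]]].
  by exists p; rewrite size_tuple.
by exists (Tuple pk); rewrite xp py eqxx.
Qed.

Lemma walk0 (V : finType) (e : rel V) (x : V) : walk e 0 x x.
Proof. by apply/walkP; exists [::]. Qed.

Lemma walk1 (V : finType) (e : rel V) (x y : V) : e x y -> walk e 1 x y.
Proof. by move=> xy; apply/walkP; exists [:: y]; rewrite /= xy. Qed.

Lemma walk_cat (V : finType) (e : rel V) j k (x y z : V) :
  walk e j x y -> walk e k y z -> walk e (j + k) x z.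
Proof.
move=> /walkP[p [<- xp py]] /walkP[p' [<- yp' p'z]]; apply/walkP.
by exists (p ++ p'); rewrite size_cat cat_path last_cat py xp.
Qed.

Lemma walk_recr (V : finType) (e : rel V) k (x z : V) :
  walk e k.+1 x z -> exists2 y, walk e k x y & e y z.
Proof.
case/walkP => p; case/lastP: p => [|p z'] []; first by [].
rewrite size_rcons rcons_path last_rcons => -[pk] /andP[xp pz'] <-.
by exists (last x p) => //; apply/walkP; exists p.
Qed.

Lemma walk_sym (V : finType) (e : rel V) k (x y : V) :
  symmetric e -> walk e k x y -> walk e k y x.
Proof.
move=> e_sym /walkP[p [<- xp <-]]; apply/walkP; exists (rev (belast x p)).
rewrite size_rev size_belast rev_path (eq_path (e' := e)) //; split=> //.
by case: p xp => //= z p _; rewrite rev_cons last_rcons.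
Qed.

Lemma card_walk (V : finType) (e : rel V) d k (x : V) :
  regular e d -> (#|[set y | walk e k x y]| <= d ^ k)%N.
Proof.
move=> e_reg; elim: k => [|k IHk].
  rewrite expn0 -(cards1 x); apply/subset_leq_card/subsetP => y.
  by rewrite !inE => /walkP[[|? ?] [] // _ _ /= ->].
apply: (@leq_trans #|\bigcup_(y in [set y | walk e k x y]) [set z | e y z]|).
  apply/subset_leq_card/subsetP => z; rewrite inE => /walk_recr[y xy yz].
  by apply/bigcupP; exists y; rewrite !inE.
apply: (@leq_trans (\sum_(y in [set y | walk e k x y]) #|[set z | e y z]|)).
  elim/big_rec2: _ => [|y m X _ Xm]; first by rewrite cards0.
  exact: leq_trans (leq_card_setU _ _) (leq_add _ _).
by under eq_bigr do rewrite e_reg; rewrite sum_nat_const expnSr leq_mul2r IHk orbT.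
Qed.

Lemma graph_dist_le_walk (V : finType) (e : rel V) k (x y : V) :
  walk e k x y -> (graph_dist e x y <= k)%N.
Proof.
move=> xy; rewrite /graph_dist leqNgt; apply/negP => k_lt.
have k_ltV : (k < #|V|)%N.
  by rewrite (leq_trans k_lt) // (leq_trans (find_size _ _)) ?size_iota.
by have := before_find 0 k_lt; rewrite nth_iota // add0n xy.
Qed.

(** Removing repeated vertices from a path makes it shorter than the number of
    vertices, so the bounded search defining the distance succeeds. *)
Lemma walk_graph_dist (V : finType) (e : rel V) (x y : V) :
  connect e x y -> walk e (graph_dist e x y) x y.
Proof.
case/connectP => p0 xp0 ->; case/shortenP: xp0 => p xp p_uniq _.
have pV : (size p < #|V|)%N by rewrite -[_.+1]/(size (x :: p)) -(card_uniqP p_uniq) max_card.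
have short_walk : has (fun k => walk e k x (last x p)) (iota 0 #|V|).
  by apply/hasP; exists (size p); rewrite ?mem_iota //; apply/walkP; exists p.
have := nth_find 0 short_walk; rewrite nth_iota //.
by rewrite -[X in (_ < X)%N](size_iota 0 #|V|) -has_find.
Qed.

Lemma diameter_attained (V : finType) (e : rel V) :
  (0 < diameter e)%N -> exists a, exists b, (diameter e <= graph_dist e a b)%N.
Proof.
move=> D0.
have [/existsP[a /existsP[b Dab]]|none] :=
    boolP [exists a, exists b, (diameter e <= graph_dist e a b)%N].
  by exists a, b.
suff : (diameter e <= (diameter e).-1)%N by rewrite leqNgt ltn_predL D0.
apply/bigmax_leqP => a _; apply/bigmax_leqP => b _.
rewrite -ltnS prednK // ltnNge; apply: contra none => Dab.
by apply/existsP; exists a; apply/existsP; exists b.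
Qed.

Lemma graph_dist0 (V : finType) (e : rel V) x : graph_dist e x x = 0%N.
Proof. by apply/eqP; rewrite -leqn0 graph_dist_le_walk // walk0. Qed.

Lemma graph_dist_sym (V : finType) (e : rel V) (x y : V) :
  connected_simple_graph e -> graph_dist e x y = graph_dist e y x.
Proof.
case=> e_sym _ e_conn; apply/eqP; rewrite eqn_leq.
by rewrite !graph_dist_le_walk // walk_sym // walk_graph_dist.
Qed.

Lemma graph_dist_triangle (V : finType) (e : rel V) (y x z : V) :
  connected_simple_graph e ->
  (graph_dist e x z <= graph_dist e x y + graph_dist e y z)%N.
Proof.
case=> _ _ e_conn; apply: graph_dist_le_walk.
by apply: walk_cat; apply: walk_graph_dist.
Qed.

Lemma graph_dist_edge (V : finType) (e : rel V) (a x y : V) :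
  connected_simple_graph e -> e x y ->
  (graph_dist e a y <= (graph_dist e a x).+1)%N.
Proof.
move=> e_graph xy; apply: leq_trans (graph_dist_triangle x a y e_graph) _.
by rewrite -addn1 leq_add2l graph_dist_le_walk // walk1.
Qed.

(** * Exponentially decaying weights *)

Definition ball (V : finType) (e : rel V) (a : V) (r : nat) : {set V} :=
  [set x | (graph_dist e a x <= r)%N].

Lemma ball_center (V : finType) (e : rel V) (a : V) r : a \in ball e a r.
Proof. by rewrite inE graph_dist0. Qed.

(** The boundary edges start on the sphere of radius r, which has at most d^r
    vertices of degree d, and each of them has weight beta^-r; the volume is
    bounded below by the weight d of the centre alone. *)
Lemma cut_ball_le (R : realType) (V : finType) (e : rel V) (d r : nat)
    (beta : R) (w : V -> V -> R) (a : V) :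
  connected_simple_graph e -> regular e d -> 0 < beta ->
  edge_weighting e w ->
  (forall y, e a y -> w a y = 1) ->
  (forall x y, e x y -> graph_dist e a x = r -> graph_dist e a y = r.+1 ->
     w x y = beta^-1 ^+ r) ->
  cut_weight e w (ball e a r) <= (d%:R / beta) ^+ r * volume e w (ball e a r).
Proof.
move=> e_graph e_reg beta_gt0 w_edge w_center w_boundary.
have [e_sym _ e_conn] := e_graph.
have vol_ge : d%:R <= volume e w (ball e a r).
  rewrite /volume (bigD1 a) ?ball_center //=; apply: ler_wpDr.
    apply: sumr_ge0 => x _; apply: sumr_ge0 => y xy.
    by have [_ /ltW] := w_edge _ _ xy.
  rewrite /vertex_weight (eq_bigr (fun=> 1)) => [|y ay]; last exact: w_center.
  by rewrite sumr_const -(e_reg a) cardsE.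
have pow_ge0 : 0 <= beta^-1 ^+ r by rewrite exprn_ge0 // invr_ge0 ltW.
apply: (@le_trans _ _ (\sum_(x in [set x | walk e r a x]) d%:R * beta^-1 ^+ r)).
  rewrite /cut_weight [leLHS]big_mkcond [leRHS]big_mkcond; apply: ler_sum => x _.
  have sphere y : e x y -> x \in ball e a r -> y \notin ball e a r ->
      graph_dist e a x = r /\ graph_dist e a y = r.+1.
    rewrite !inE -ltnNge => xy xr yr.
    have := graph_dist_edge a e_graph xy; lia.
  rewrite [x \in [set _ | _]]inE.
  have [ax|Nax] := eqVneq (graph_dist e a x) r.
    have -> : walk e r a x by rewrite -{1}ax walk_graph_dist.
    rewrite inE ax leqnn -(e_reg x) cardsE mulr_natl -sumr_const.
    rewrite [leRHS](bigID (fun y => y \notin ball e a r)) /=.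
    rewrite ler_wpDr ?sumr_ge0 // ler_sum // => y /andP[xy yr].
    rewrite -(w_boundary x y) //; apply: (sphere y xy _ yr).2.
    by rewrite inE ax.
  have -> : (if x \in ball e a r then
      \sum_(y | e x y && (y \notin ball e a r)) w x y else 0) = 0.
    case: ifP => // xr; apply: big1 => y /andP[xy yr].
    by case/eqP: Nax; apply: (sphere y xy xr yr).1.
  by case: ifP => // _; rewrite mulr_ge0.
rewrite sumr_const -[X in X <= _]mulr_natr.
have card_r : #|[set x | walk e r a x]|%:R <= d%:R ^+ r :> R.
  by rewrite -natrX ler_nat card_walk.
rewrite expr_div_n mulrC.
have -> : d%:R ^+ r / beta ^+ r * volume e w (ball e a r) =
  d%:R ^+ r * (volume e w (ball e a r) * beta^-1 ^+ r) by rewrite exprVn; ring.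
by rewrite ler_pM // ?mulr_ge0 // ler_wpM2r.
Qed.

(** As y ranges over the neighbours of x, the minimum of h x and h y takes only
    the values h x and h x - 1, so two such weights differ by a factor of at most beta. *)
Lemma min_edge_lipschitz (R : realType) (V : finType) (e : rel V) (beta : R)
    (h : V -> nat) :
  symmetric e -> 1 < beta -> (forall x y, e x y -> (h y <= (h x).+1)%N) ->
  lipschitz_weighting e beta (fun x y => beta^-1 ^+ minn (h x) (h y)).
Proof.
move=> e_sym beta_gt1 h_edge x y z xy xz.
have beta_gt0 : 0 < beta by apply: lt_trans beta_gt1.
have hxy : (h x <= (h y).+1)%N by apply: h_edge; rewrite e_sym.
have hxz : (h x <= (h z).+1)%N by apply: h_edge; rewrite e_sym.
have bound i j : (i <= j.+1)%N -> beta^-1 ^+ j <= beta * beta^-1 ^+ i.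
  move=> ij; rewrite -[leLHS](mulVKf (lt0r_neq0 beta_gt0)) ?ler_pM2l //.
  rewrite -exprS ler_wiXn2l //; last by rewrite invf_le1 // ltW.
  by rewrite invr_ge0 ltW.
have pow_gt0 i : 0 < beta^-1 ^+ i by rewrite exprn_gt0 // invr_gt0.
rewrite div1r ler_pdivlMr // ler_pdivrMr // ler_pdivrMl //.
by rewrite !bound //; lia.
Qed.

Theorem proposition1p2 (R : realType) (V : finType) (e : rel V) (d D : nat)
    (graph_e : connected_simple_graph e)
    (regular_e : regular e d)
    (diameter_e : diameter e = D)
    (D_ge4 : (4 <= D)%N)
    (beta : R) (beta_gt1 : 1 < beta) :
  exists w : V -> V -> R,
    [/\ edge_weighting e w,
        lipschitz_weighting e beta w
      & spectral_gap (induced_chain e w)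
          <= beta ^+ 2 * (d%:R / beta) ^+ (D./2 - 1)%N].
Proof.
have [e_sym _ e_conn] := graph_e.
have beta_gt0 : 0 < beta by apply: lt_trans beta_gt1.
have [|a [b]] := @diameter_attained _ e; rewrite diameter_e; first exact: leq_trans D_ge4.
move=> ab_far; set r := (D./2 - 1)%N.
have r_D : (r.+1.*2 <= D)%N by lia.
pose h x := minn (graph_dist e a x) (graph_dist e b x).
have far x : (D <= graph_dist e a x + graph_dist e b x)%N.
  rewrite (graph_dist_sym b) //; apply: leq_trans ab_far _.
  exact: graph_dist_triangle.
have a_edge x y := @graph_dist_edge _ e a x y graph_e.
have b_edge x y := @graph_dist_edge _ e b x y graph_e.
have h_edge x y : e x y -> (h y <= (h x).+1)%N.
  by move=> xy; rewrite /h; have := a_edge x y xy; have := b_edge x y xy; lia.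
pose w x y : R := beta^-1 ^+ minn (h x) (h y).
have w_edge : edge_weighting e w.
  by move=> x y _; rewrite /w minnC; split=> //; rewrite exprn_gt0 // invr_gt0.
(* The degree is positive: a walk from a to b leaves a. *)
have has_neighbour x : exists y, e x y.
  have : (0 < #|[set y | e a y]|)%N.
    have := walk_graph_dist (e_conn a b); case E : graph_dist => [|k].
      by move: ab_far; rewrite E; lia.
    case/walkP => -[|y p] [] //= _ /andP[ay _] _.
    by apply/card_gt0P; exists y; rewrite inE.
  by rewrite regular_e -(regular_e x) => /card_gt0P[y]; rewrite inE; exists y.
exists w; split=> //; first exact: min_edge_lipschitz.
apply: (@le_trans _ _ ((d%:R / beta) ^+ r)); last first.
  apply: ler_peMl; last by rewrite exprn_ege1 // ltW.
  by rewrite exprn_ge0 // divr_ge0 // ltW.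
apply: (@spectral_gap_le_cut _ _ _ _ (ball e a r) (ball e b r)) => //.
- move=> x; have [y xy] := has_neighbour x.
  rewrite /vertex_weight (bigD1 y) //= ltr_pwDl //; first by have [] := w_edge _ _ xy.
  by apply: sumr_ge0 => z /andP[xz _]; have [_ /ltW] := w_edge _ _ xz.
- by apply/set0Pn; exists a; apply: ball_center.
- by apply/set0Pn; exists b; apply: ball_center.
- apply/pred0P => x /=; rewrite !inE; have := far x; lia.
- move=> x y; rewrite !inE => ax bx; apply/negP => xy.
  have := far y; have := a_edge x y xy; lia.
- apply: cut_ball_le => // [y ay|x y xy ax ay].
    by rewrite /w /h graph_dist0 !min0n expr0.
  by rewrite /w; congr (_ ^+ _); rewrite /h; have := far x; have := far y; lia.
apply: cut_ball_le => // [y ay|x y xy bx bY].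
  by rewrite /w /h graph_dist0 minn0 min0n expr0.
by rewrite /w; congr (_ ^+ _); rewrite /h; have := far x; have := far y; lia.
Qed.
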